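(* Let $I\subset\mathbf k[\mathbf x]$ be a monomial ideal with cofinite support and $x_j\notin I$ for all $j$. Let $\gamma$ be an inner root of the form $\gamma=\ell e_i$ with $\ell>2$. Then for every $r\in N_{\mathbf k}$ there exist $p,q\in N_{\mathbf k}$ and inner roots $\alpha,\beta$ different from $\gamma$ with $\alpha+\beta=\gamma$ such that $[\overline\partial_{\alpha,p},\overline\partial_{\beta,q}]=\overline\partial_{\gamma,r}$. In particular, any such root $\gamma$ is reducible.
   Context: Setting: $\mathbf k$ is an algebraically closed field of characteristic zero, $n\ge1$, $M=\mathbb Z^n$ with canonical basis $E=\{e_1,\dots,e_n\}$, and $N_{\mathbf k}=\operatorname{Hom}(M,\mathbf k)\cong\mathbf k^n$ with dual basis $e_1^*,\dots,e_n^*$. $\mathbf k[\mathbf x]=\mathbf k[x_1,\dots,x_n]$ and $\mathbf x^m=x_1^{m_1}\cdots x_n^{m_n}$. For a monomial ideal $I$, $\operatorname{supp}(I)=\{m\in\mathbb Z^n_{\ge0}:\mathbf x^m\in I\}$; $I$ has cofinite support if $\mathbb Z^n_{\ge0}\setminus\operatorname{supp}(I)$ is finite. Set $A=\mathbf k[\mathbf x]/I$. For $\alpha\in\mathbb Z^n$ and $p\in N_{\mathbf k}$, $\partial_{\alpha,p}$ denotes the homogeneous derivation $\mathbf x^m\mapsto p(m)\mathbf x^{m+\alpha}$ of $\mathbf k[\mathbf x]$ (whenever it maps $\mathbf k[\mathbf x]$ to itself), and $\overline\partial_{\alpha,p}$ the derivation induced on $A$ when $\partial_{\alpha,p}(I)\subseteq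 I$ (automatic for $\alpha\in\mathbb Z^n_{\ge0}$). A root is a degree $\alpha\in\mathbb Z^n\setminus\{0\}$ for which there is a nonzero homogeneous derivation of $A$ of degree $\alpha$; $\mathcal R(I)$ is the set of roots; a root is inner if it lies in $\mathbb Z^n_{\ge0}$ and outer otherwise. An inner degree $\alpha\neq0$ is a root iff there is $j$ with $\alpha+e_j\notin\operatorname{supp}(I)$. $\mathfrak g_\alpha\subset\operatorname{Der}_{\mathbf k}(A)$ is the space of homogeneous derivations of degree $\alpha$ (for $\alpha$ inner, $\mathfrak g_\alpha=\{\overline\partial_{\alpha,p}:p\in N_{\mathbf k}\}$). For a root $\gamma$, $B_\gamma=\sum[\mathfrak g_\alpha,\mathfrak g_\beta]$, sum over $\alpha,\beta\in\mathcal R(I)$ with $\alpha+\beta=\gamma$; $\gamma$ is reducible if $B_\gamma=\mathfrak g_\gamma$. *)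

(* Defs.v *)
From HB Require Import structures.
From mathcomp Require Import all_boot all_order all_algebra.
From mathcomp Require Export mpoly.

Set Implicit Arguments.
Unset Strict Implicit.
Unset Printing Implicit Defensive.

Import Order.TTheory GRing.Theory Num.Theory.
Local Open Scope ring_scope.
Local Open Scope quotient_scope.

Section Lattice.
Variable n : nat.

(* deg is the lattice M = Z^n, dualN is N_k = Hom(M, k). *)
Definition deg := 'rV[int]_n.

Definition ebase (i : 'I_n) : deg := delta_mx 0 i.

Definition mexp (m : 'X_{1..n}) : deg := \row_i (m i)%:Z.

Definition nonneg (a : deg) : bool := [forall i, 0 <= a 0 i].

Definition dualN (k : fieldType) := {additive deg -> k}.

(* x^a for an arbitrary exponent a in Z^n, extended by 0 when x^a is not a
   polynomial. *)
Definition xmon (k : fieldType) (a : deg) : {mpoly k[n]} :=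
  if nonneg a then 'X_[[multinom absz (a 0%R i) | i < n]] else 0.

(* The map x^m |-> p(m) x^(m + a) extended linearly.  Terms with m + a outside
   Z^n_{>=0} contribute 0; when the derivation preserves k[x] their coefficient
   p(m) is zero anyway. *)
Definition hder (k : fieldType) (a : deg) (p : dualN k) (f : {mpoly k[n]}) :
    {mpoly k[n]} :=
  \sum_(m <- msupp f) (f@_m * p (mexp m)) *: xmon k (mexp m + a).

End Lattice.

Section MonomialIdeals.
Variables (k : fieldType) (n : nat).

Definition monomial_ideal (I : {pred {mpoly k[n]}}) : Prop :=
  exists S : 'X_{1..n} -> Prop, forall f : {mpoly k[n]},
    f \in I <->
    exists s : seq ({mpoly k[n]} * 'X_{1..n}),
      (forall u, u \in s -> S u.2) /\ f = \sum_(u <- s) u.1 * 'X_[u.2].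

Definition supp (I : {pred {mpoly k[n]}}) : {pred 'X_{1..n}} :=
  [pred m | 'X_[m] \in I].

Definition cofinite_support (I : {pred {mpoly k[n]}}) : Prop :=
  exists s : seq 'X_{1..n}, forall m, m \notin supp I -> m \in s.

End MonomialIdeals.

Section QuotientAlgebra.
Variables (k : fieldType) (n : nat) (I : idealr {mpoly k[n]}).

Definition qalg := {ideal_quot I}.

HB.instance Definition _ := GRing.ComNzRing.on qalg.
HB.instance Definition _ := Quotient.on qalg.

Definition qpi (f : {mpoly k[n]}) : qalg := \pi_({ideal_quot I}) f.

Lemma qpiD f g : qpi (f + g) = qpi f + qpi g.
Proof. exact: (rmorphD (\pi_({ideal_quot I}) : {rmorphism _ -> _})). Qed.

Lemma qpiM f g : qpi (f * g) = qpi f * qpi g.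
Proof. exact: (rmorphM (\pi_({ideal_quot I}) : {rmorphism _ -> _})). Qed.

Lemma qpi1 : qpi 1 = 1.
Proof. exact: (rmorph1 (\pi_({ideal_quot I}) : {rmorphism _ -> _})). Qed.

Lemma qpi_eq f g : (qpi f == qpi g) = (f - g \in (I : {pred _})).
Proof. by rewrite /qpi -Quotient.idealrBE. Qed.

Definition qscale (c : k) (a : qalg) : qalg := qpi c%:MP * a.

Fact qscaleA a b v : qscale a (qscale b v) = qscale (a * b) v.
Proof. by rewrite /qscale mulrA -qpiM -mpolyCM. Qed.

Fact qscale1 : left_id 1 qscale.
Proof. by move=> v; rewrite /qscale mpolyC1 qpi1 mul1r. Qed.

Fact qscaleDr : right_distributive qscale +%R.
Proof. by move=> a u v; rewrite /qscale mulrDr. Qed.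

Fact qscaleDl v : {morph qscale^~ v : a b / a + b}.
Proof. by move=> a b; rewrite /qscale mpolyCD qpiD mulrDl. Qed.

HB.instance Definition _ :=
  GRing.Zmodule_isLmodule.Build k qalg qscaleA qscale1 qscaleDr qscaleDl.

Fact qscaleAl (c : k) (a b : qalg) : c *: (a * b) = c *: a * b.
Proof. exact: mulrA. Qed.

HB.instance Definition _ := GRing.Lmodule_isLalgebra.Build k qalg qscaleAl.

Lemma qpiZ c f : qpi (c *: f) = c *: qpi f.
Proof. by rewrite -mul_mpolyC qpiM. Qed.

Definition derivation (D : qalg -> qalg) : Prop :=
  linear D /\ forall a b : qalg, D (a * b) = D a * b + a * D b.

Definition bracket (D1 D2 : qalg -> qalg) : qalg -> qalg :=
  fun a => D1 (D2 a) - D2 (D1 a).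

(* [A_m is the line (or 0) spanned by the class of x^m; D maps A_m to A_(m+a).
   The condition forces D to kill A_m when m + a is not in Z^n_{>=0}. *)
Definition homogeneous (a : deg n) (D : qalg -> qalg) : Prop :=
  forall m : 'X_{1..n}, exists c : k,
    D (qpi 'X_[m]) = c *: qpi (xmon k (mexp m + a)).

Definition gspace (a : deg n) (D : qalg -> qalg) : Prop :=
  derivation D /\ homogeneous a D.

Definition is_root (a : deg n) : Prop :=
  a != 0 /\ exists2 D, gspace a D & exists x, D x != 0.

Definition inner_root (a : deg n) : Prop := is_root a /\ nonneg a.

(* The sum of the subspaces [g_a, g_b]: a finite linear combination of
   brackets, where the pair of roots may change from one term to the next. *)
Definition Bspace (g : deg n) (D : qalg -> qalg) : Prop :=
  exists (N : nat) (c : 'I_N -> k) (a b : 'I_N -> deg n)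
         (D1 D2 : 'I_N -> qalg -> qalg),
    (forall j, [/\ is_root (a j), is_root (b j), a j + b j = g,
                   gspace (a j) (D1 j) & gspace (b j) (D2 j)])
    /\ forall x, D x = \sum_(j < N) c j *: bracket (D1 j) (D2 j) x.

Definition reducible (g : deg n) : Prop :=
  is_root g /\ forall D, Bspace g D <-> gspace g D.

(* The map induced by hder a p on A.  Choosing a representative is harmless
   as soon as hder a p maps I into itself, see hder_bar_pi. *)
Definition hder_bar (a : deg n) (p : dualN n k) (x : qalg) : qalg :=
  qpi (hder a p (repr x)).

End QuotientAlgebra.

Section Induced.
Variables (k : fieldType) (n : nat) (I : idealr {mpoly k[n]}).
Implicit Types (a : deg n) (p : dualN n k) (f g : {mpoly k[n]}).

Lemma hderEw a p f d : (msize f <= d)%N ->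
  hder a p f =
    \sum_(m : 'X_{1..n < d}) (f@_m * p (mexp m)) *: xmon k (mexp m + a).
Proof.
move=> hd; rewrite /hder (ssrcomplements.big_mksub 'X_{1..n < d}) //=; first last.
- by move=> m /msize_mdeg_lt /leq_trans; apply.
- exact: msupp_uniq.
rewrite big_rmcond //= => m /memN_msupp_eq0 ->.
by rewrite mul0r scale0r.
Qed.

Lemma hderD a p f g : hder a p (f + g) = hder a p f + hder a p g.
Proof.
pose d := maxn (msize (f + g)) (maxn (msize f) (msize g)).
rewrite !(@hderEw a p _ d) ?leq_max ?leqnn ?orbT // -big_split /=.
by apply: eq_bigr => m _; rewrite mcoeffD mulrDl scalerDl.
Qed.

Lemma hderZ a p c f : hder a p (c *: f) = c *: hder a p f.
Proof.
pose d := maxn (msize (c *: f)) (msize f).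
rewrite !(@hderEw a p _ d) ?leq_max ?leqnn ?orbT // scaler_sumr.
by apply: eq_bigr => m _; rewrite mcoeffZ -mulrA scalerA.
Qed.

Lemma hder0 a p : hder a p 0 = 0.
Proof. by rewrite /hder msupp0 big_nil. Qed.

Lemma hder_sum a p (T : Type) (r : seq T) (F : T -> {mpoly k[n]}) :
  hder a p (\sum_(u <- r) F u) = \sum_(u <- r) hder a p (F u).
Proof.
elim: r => [|u r IH]; first by rewrite !big_nil hder0.
by rewrite !big_cons hderD IH.
Qed.

Lemma hderX a p (m : 'X_{1..n}) :
  hder a p 'X_[m] = p (mexp m) *: xmon k (mexp m + a).
Proof. by rewrite /hder msuppX big_seq1 mcoeffX eqxx mul1r. Qed.

Lemma xmonD (m : 'X_{1..n}) a : nonneg a ->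
  xmon k (mexp m + a) = 'X_[m] * xmon k a.
Proof.
move=> a_ge0; have ma_ge0 : nonneg (mexp m + a).
  apply/forallP => i; rewrite !mxE addr_ge0 //.
  by have /forallP := a_ge0; apply.
rewrite /xmon a_ge0 ma_ge0 -mpolyXD; congr 'X_[_].
apply/mnmP => i; rewrite mnmDE !mnmE !mxE.
have /forallP/(_ i) := a_ge0; by case: (a 0 i).
Qed.

Lemma hder_monomial_ideal a p : nonneg a -> monomial_ideal I ->
  forall f, f \in (I : {pred _}) -> hder a p f \in (I : {pred _}).
Proof.
move=> a_ge0 [S hS] f /hS [s [sS ->]]; rewrite hder_sum big_seq.
apply: rpred_sum => u us.
have Xu : 'X_[u.2] \in (I : {pred {mpoly k[n]}}).
  apply/hS; exists [:: (1, u.2)]; split; last by rewrite big_seq1 mul1r.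
  by move=> v; rewrite inE => /eqP -> /=; exact: sS us.
rewrite [u.1]mpolyE mulr_suml hder_sum; apply: rpred_sum => m _.
rewrite -scalerAl hderZ -mpolyXD hderX xmonD // mpolyXD.
rewrite scalerA -mul_mpolyC mulrAC mulrA.
exact: idealMr.
Qed.

Lemma hder_bar_pi a p :
  (forall f, f \in (I : {pred _}) -> hder a p f \in (I : {pred _})) ->
  forall f, hder_bar a p (qpi I f) = qpi I (hder a p f).
Proof.
move=> hI f; apply/eqP; rewrite /hder_bar qpi_eq.
set g := repr _; have hg : g - f \in (I : {pred _}).
  by rewrite -qpi_eq /qpi reprK.
by rewrite -{1}[g](subrK f) hderD addrK; apply: hI.
Qed.

End Induced.

(* Main.v *)
Require Import Defs.
From HB Require Import structures.
From mathcomp Require Import all_boot all_order all_algebra.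
From mathcomp Require Import mpoly ring.
Import GRing.Theory.
Local Open Scope ring_scope.

(** On monomials one computes, for degrees [a] and [b] in the positive orthant,
      [d_(a,p), d_(b,q)] = d_(a+b, p(b) q - q(a) p).
    Take [a = e_i] and [b = (l-1) e_i], and let [p] be the [i]-th coordinate
    functional [u].  Then the right-hand functional is [(l-1) q - q(e_i) u], and
    [q |-> (l-1) q - q(e_i) u] is a linear endomorphism of the dual space: it
    acts as [l-1] on the functionals killing [e_i] and as [l-2] on the line of
    [u].  In characteristic zero it is invertible because [l > 2], so every [r]
    is reached; the preimage is [q = (r + c u) / (l-1)] with
    [c = r(e_i) / (l-2)].  This is [bracket_axis_onto].

    Both degrees are roots because being an inner root passes to nonzero
    summands ([inner_root_summand]): some [x_j x^(a+b)] survives in the quotient,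
    hence so does its divisor [x_j x^a].

    Reducibility follows because every homogeneous derivation of inner degree is
    some [d_(a,r)] ([gspace_hder_barP]), so that a single bracket already gives
    all of the target space; conversely brackets and linear combinations stay
    homogeneous derivations ([Bspace_gspace]).

    Equalities between derivations of the quotient are obtained by
    comparing values on the variables ([derivation_ext]), which is also why only
    the values of functionals on the canonical basis matter.  Degrees in the
    positive orthant are handled as [mexp a] with [a] a multi-exponent, so that
    the partially defined monomials [xmon] become honest ones. *)

(** * Exponents in the positive orthant *)

Section Degrees.
Set Implicit Arguments.
Unset Strict Implicit.
Unset Printing Implicit Defensive.
Variable n : nat.
Implicit Types (m : 'X_{1..n}) (a b : deg n) (i j : 'I_n).

Lemma addmAC : right_commutative (@mnm_add n).
Proof. exact: Monoid.mulmAC. Qed.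

Lemma mexpD m1 m2 : mexp (m1 + m2)%MM = mexp m1 + mexp m2.
Proof. by apply/rowP => j; rewrite !mxE mnmDE PoszD. Qed.

Lemma mexp1 j : mexp U_(j)%MM = ebase j.
Proof.
apply/rowP => h; rewrite !mxE mnm1E eqxx /= eq_sym.
by case: (h == j).
Qed.

Lemma mexp_muln m l : mexp (m *+ l)%MM = mexp m *+ l.
Proof. by apply/rowP => j; rewrite mulmxnE !mxE mulmnE PoszM -mulrzz -pmulrn. Qed.

Lemma ebase_muln j l : ebase j *+ l = mexp (U_(j) *+ l)%MM.
Proof. by rewrite mexp_muln mexp1. Qed.

Lemma nonneg_mexp m : nonneg (mexp m).
Proof. by apply/forallP => j; rewrite mxE. Qed.

Lemma nonnegP a : reflect (exists m, a = mexp m) (nonneg a).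
Proof.
apply: (iffP idP) => [/forallP a0|[m ->]]; last exact: nonneg_mexp.
exists [multinom absz (a 0%R h) | h < n]; apply/rowP => h.
by rewrite mxE mnmE gez0_abs.
Qed.

Lemma xmon_mexp (k : fieldType) m : xmon k (mexp m) = 'X_[m].
Proof.
rewrite /xmon nonneg_mexp; congr 'X_[_].
by apply/mnmP => h; rewrite mnmE mxE.
Qed.

Lemma xmon_negF (k : fieldType) a : ~~ nonneg a -> xmon k a = 0.
Proof. by rewrite /xmon => /negbTE ->. Qed.

End Degrees.

(** * Derivations of the quotient and their degrees *)

Section Derivations.
Set Implicit Arguments.
Unset Strict Implicit.
Unset Printing Implicit Defensive.
Variables (k : fieldType) (n : nat) (I : idealr {mpoly k[n]}).
Implicit Types (a b : deg n) (p q r : dualN n k) (D : qalg I -> qalg I).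

Definition dual_of (c : 'I_n -> k) (a : deg n) : k :=
  \sum_j c j * (a 0 j)%:~R.

Fact dual_of_is_additive c : zmod_morphism (dual_of c).
Proof.
move=> a b; rewrite /dual_of -sumrB; apply: eq_bigr => j _.
by rewrite !mxE rmorphB mulrBr.
Qed.

HB.instance Definition _ c :=
  GRing.isZmodMorphism.Build (deg n) k (dual_of c) (dual_of_is_additive c).

Lemma dual_of_ebase c j : dual_of c (ebase j) = c j.
Proof.
rewrite /dual_of (bigD1 j) //= mxE !eqxx mulr1 big1 ?addr0 // => h hj.
by rewrite mxE (negbTE hj) andbF mulr0.
Qed.

Lemma qpi_repr (x : qalg I) : qpi I (repr x) = x.
Proof. exact: reprK. Qed.

Lemma qpi0 : qpi I 0 = 0.
Proof. by apply: (addIr (qpi I 0)); rewrite -qpiD !add0r. Qed.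

Lemma qpi_sum (T : Type) (s : seq T) (F : T -> {mpoly k[n]}) :
  qpi I (\sum_(u <- s) F u) = \sum_(u <- s) qpi I (F u).
Proof. by apply: (big_morph _ (qpiD I) qpi0). Qed.

Lemma qpi_eq0 f : (qpi I f == 0) = (f \in (I : {pred _})).
Proof. by rewrite -qpi0 qpi_eq subr0. Qed.

Section OneDerivation.
Context {D} (derD : derivation D).

Lemma der_add x y : D (x + y) = D x + D y.
Proof. by have := derD.1 1 x y; rewrite !scale1r. Qed.

Lemma der0 : D 0 = 0.
Proof. by apply: (addIr (D 0)); rewrite -der_add !add0r. Qed.

Lemma der_scale c x : D (c *: x) = c *: D x.
Proof. by have := derD.1 c x 0; rewrite der0 !addr0. Qed.

Lemma der_sum (T : Type) (s : seq T) (F : T -> qalg I) :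
  D (\sum_(u <- s) F u) = \sum_(u <- s) D (F u).
Proof. by apply: (big_morph D der_add der0). Qed.

Lemma der1 : D 1 = 0.
Proof.
have := derD.2 1 1; rewrite !mulr1 mul1r => /esym/eqP.
by rewrite -subr_eq0 addrK => /eqP.
Qed.

End OneDerivation.

(** A derivation vanishes on constants, so the polynomials on which two of them
    agree form a subalgebra; containing the variables, it is everything. *)
Lemma derivation_ext D1 D2 : derivation D1 -> derivation D2 ->
  (forall j, D1 (qpi I 'X_j) = D2 (qpi I 'X_j)) -> forall x, D1 x = D2 x.
Proof.
move=> d1 d2 eqX x; rewrite -(qpi_repr x) [repr x]mpolyE qpi_sum.
rewrite (der_sum d1) (der_sum d2); apply: eq_bigr => m _.
rewrite qpiZ (der_scale d1) (der_scale d2); congr (_ *: _).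
pose P f := D1 (qpi I f) = D2 (qpi I f).
have P1 : P 1 by rewrite /P qpi1 (der1 d1) (der1 d2).
have PM f g : P f -> P g -> P (f * g).
  by rewrite /P qpiM d1.2 d2.2 => -> ->.
rewrite mpolyXE_id; apply: (big_ind P) => // j _.
by elim: (m j) => [|e IH]; rewrite ?expr0 // exprS; apply: PM.
Qed.

Lemma derivation0 : derivation (fun _ : qalg I => 0).
Proof. by split=> [c x y|x y]; rewrite ?scaler0 ?mul0r ?mulr0 addr0. Qed.

Lemma derivation_lincomb N (c : 'I_N -> k) (D : 'I_N -> qalg I -> qalg I) :
  (forall j, derivation (D j)) -> derivation (fun x => \sum_j c j *: D j x).
Proof.
move=> dD; split=> [e x y|x y].
  rewrite scaler_sumr -big_split; apply: eq_bigr => j _ /=.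
  by rewrite (der_add (dD j)) (der_scale (dD j)) scalerDr !scalerA mulrC.
rewrite mulr_suml mulr_sumr -big_split; apply: eq_bigr => j _ /=.
rewrite (dD j).2 scalerDr scalerAl; congr (_ + _).
by rewrite /GRing.scale /= /qscale mulrCA.
Qed.

Lemma derivation_bracket D1 D2 :
  derivation D1 -> derivation D2 -> derivation (bracket D1 D2).
Proof.
move=> d1 d2; split=> [e x y|x y]; rewrite /bracket.
  rewrite !(der_add d1, der_add d2, der_scale d1, der_scale d2).
  by rewrite scalerBr opprD addrACA.
rewrite d1.2 d2.2 (der_add d1) (der_add d2) !d1.2 !d2.2.
by ring.
Qed.

(** If [m + b] leaves the positive orthant, homogeneity forces [D2] to kill
    [x^m], and the composite kills it too even when [m + a + b] is back in the
    orthant; hence the case distinction. *)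
Lemma homogeneous_comp a b D1 D2 : derivation D1 ->
  homogeneous a D1 -> homogeneous b D2 -> homogeneous (a + b) (D1 \o D2).
Proof.
move=> d1 h1 h2 m; have [c2 /= ->] := h2 m; rewrite (der_scale d1).
have [/nonnegP[m' mb]|/xmon_negF->] := boolP (nonneg (mexp m + b)).
  have [c1 D1m'] := h1 m'; exists (c2 * c1).
  by rewrite mb xmon_mexp D1m' scalerA -mb [a + b]addrC addrA.
by exists 0; rewrite qpi0 (der0 d1) scaler0 scale0r.
Qed.

Lemma homogeneous_bracket a b D1 D2 : derivation D1 -> derivation D2 ->
  homogeneous a D1 -> homogeneous b D2 -> homogeneous (a + b) (bracket D1 D2).
Proof.
move=> d1 d2 h1 h2 m.
have [c1 /= E1] := homogeneous_comp d1 h1 h2 m.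
have [c2 /= E2] := homogeneous_comp d2 h2 h1 m.
by exists (c1 - c2); rewrite /bracket E1 E2 [b + a]addrC scalerBl.
Qed.

Lemma homogeneous_lincomb N a (c : 'I_N -> k) (D : 'I_N -> qalg I -> qalg I) :
  (forall j, homogeneous a (D j)) ->
  homogeneous a (fun x => \sum_j c j *: D j x).
Proof.
move=> hD m; have /fin_all_exists[e De] j := hD j m.
exists (\sum_j c j * e j); rewrite scaler_suml; apply: eq_bigr => j _.
by rewrite De scalerA.
Qed.

Lemma gspace_bracket a b D1 D2 :
  gspace a D1 -> gspace b D2 -> gspace (a + b) (bracket D1 D2).
Proof.
move=> [d1 h1] [d2 h2]; split; first exact: derivation_bracket.
exact: homogeneous_bracket.
Qed.

Lemma gspace_lincomb N a (c : 'I_N -> k) (D : 'I_N -> qalg I -> qalg I) :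
  (forall j, gspace a (D j)) -> gspace a (fun x => \sum_j c j *: D j x).
Proof.
move=> gD; split; first by apply: derivation_lincomb => j; exact: (gD j).1.
by apply: homogeneous_lincomb => j; exact: (gD j).2.
Qed.

Lemma eq_gspace a D1 D2 : D1 =1 D2 -> gspace a D2 -> gspace a D1.
Proof.
move=> eqD [d2 h2]; split; last by move=> m; rewrite eqD; exact: h2.
by split=> [c x y|x y]; rewrite !eqD ?d2.1 ?d2.2.
Qed.

Lemma Bspace_gspace a D : Bspace a D -> gspace a D.
Proof.
move=> [N [c [a1 [a2 [D1 [D2 [hD /eq_gspace]]]]]]]; apply.
by apply: gspace_lincomb => j; have [_ _ <- g1 g2] := hD j; apply: gspace_bracket.
Qed.

(** * The derivations of inner degree *)

Lemma hder_mexpX (a m : 'X_{1..n}) p :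
  hder (mexp a) p 'X_[m] = p (mexp m) *: 'X_[m + a].
Proof. by rewrite hderX -mexpD xmon_mexp. Qed.

(** The Leibniz rule reduces by bilinearity to two monomials, where it says that
    [p] is additive on exponents. *)
Lemma hder_mexpM (a : 'X_{1..n}) p f g :
  hder (mexp a) p (f * g) =
    hder (mexp a) p f * g + f * hder (mexp a) p g.
Proof.
have hMX m1 m2 : hder (mexp a) p ('X_[m1] * 'X_[m2]) =
    hder (mexp a) p 'X_[m1] * 'X_[m2] + 'X_[m1] * hder (mexp a) p 'X_[m2].
  rewrite -mpolyXD !hder_mexpX mexpD raddfD scalerDl.
  by rewrite -scalerAl -scalerAr -!mpolyXD addmA [(m1 + a + m2)%MM]addmAC.
have hMl m1 : hder (mexp a) p ('X_[m1] * g) =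
    hder (mexp a) p 'X_[m1] * g + 'X_[m1] * hder (mexp a) p g.
  rewrite [g]mpolyE [in LHS]mulr_sumr !hder_sum [in RHS]mulr_sumr.
  rewrite [X in _ + X]mulr_sumr -big_split /=.
  apply: eq_bigr => m2 _; rewrite -!scalerAr !hderZ -scalerAr -scalerDr.
  by rewrite hMX.
rewrite [f]mpolyE [in LHS]mulr_suml !hder_sum [in RHS]mulr_suml.
rewrite [X in _ + X]mulr_suml -big_split /=.
apply: eq_bigr => m1 _; rewrite -!scalerAl !hderZ -scalerAl -scalerDr.
by rewrite hMl.
Qed.

Hypothesis I_mono : monomial_ideal I.

Lemma hder_bar_mexp (a : 'X_{1..n}) p f :
  hder_bar (mexp a) p (qpi I f) = qpi I (hder (mexp a) p f).
Proof.
apply: hder_bar_pi; apply: hder_monomial_ideal I_mono; exact: nonneg_mexp.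
Qed.

Lemma hder_bar_mexpX (a m : 'X_{1..n}) p :
  hder_bar (mexp a) p (qpi I 'X_[m]) = p (mexp m) *: qpi I 'X_[m + a].
Proof. by rewrite hder_bar_mexp hder_mexpX qpiZ. Qed.

Lemma gspace_hder_bar (a : 'X_{1..n}) p :
  gspace (mexp a) (@hder_bar k n I (mexp a) p).
Proof.
split; last first.
  by move=> m; exists (p (mexp m)); rewrite hder_bar_mexpX -mexpD xmon_mexp.
split=> [c x y|x y]; rewrite -(qpi_repr x) -(qpi_repr y).
  by rewrite -qpiZ -qpiD !hder_bar_mexp hderD hderZ qpiD qpiZ.
by rewrite -qpiM !hder_bar_mexp hder_mexpM qpiD !qpiM.
Qed.

(** Homogeneity prescribes [D x_j = c_j x^(e_j + a)], and the functional with
    coordinates [c_j] reproduces these values. *)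
Lemma gspace_hder_barP (a : 'X_{1..n}) D : gspace (mexp a) D ->
  exists r, forall x, D x = hder_bar (mexp a) r x.
Proof.
move=> [dD hD]; have /fin_all_exists[c Dc] j := hD U_(j)%MM.
exists (dual_of c); apply: derivation_ext => // [|j].
  exact: (gspace_hder_bar _ _).1.
by rewrite Dc hder_bar_mexpX mexp1 /= dual_of_ebase -mexp1 -mexpD xmon_mexp.
Qed.

(** The commutator formula: the quadratic terms [p(m) q(m)] cancel, leaving a
    functional that is again linear in [m]. *)
Lemma bracket_hder_bar (a b : 'X_{1..n}) p q r :
  (forall j, r (ebase j) = p (mexp b) * q (ebase j) - q (mexp a) * p (ebase j)) ->
  forall x : qalg I,
    bracket (hder_bar (mexp a) p) (hder_bar (mexp b) q) x =
      hder_bar (mexp (a + b)%MM) r x.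
Proof.
move=> rE; have ga := gspace_hder_bar a p; have gb := gspace_hder_bar b q.
apply: derivation_ext => [||j]; first exact: derivation_bracket ga.1 gb.1.
  exact: (gspace_hder_bar _ _).1.
rewrite /bracket !hder_bar_mexpX (der_scale ga.1) (der_scale gb.1).
rewrite !hder_bar_mexpX !scalerA !mexpD !raddfD /= mexp1 rE.
rewrite addmA [(U_(j) + b + a)%MM]addmAC -scalerBl; congr (_ *: _).
by ring.
Qed.

(** If all the [x_j x^a] lie in [I], a derivation of degree [a] kills every
    variable.  Otherwise the functional with all coordinates 1 gives a derivation
    sending the surviving variable [x_j] to [x_j x^a], which is not zero. *)
Lemma inner_rootP (a : 'X_{1..n}) :
  inner_root I (mexp a) <->
    mexp a != 0 /\ exists j, 'X_[U_(j) + a] \notin (I : {pred {mpoly k[n]}}).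
Proof.
split=> [[[a0 [D [dD hD] [x Dx]]] _]|[a0 [j Xj]]]; split=> //; last 2 first.
- split=> //; exists (hder_bar (mexp a) (dual_of (fun _ => 1))).
    exact: gspace_hder_bar.
  exists (qpi I 'X_j); rewrite hder_bar_mexpX mexp1 /= dual_of_ebase scale1r.
  by rewrite qpi_eq0.
- exact: nonneg_mexp.
apply/existsP; apply: contraNT Dx => /existsPn allI; apply/eqP.
apply: (derivation_ext dD derivation0) => j; have [c ->] := hD U_(j)%MM.
apply/eqP; rewrite -mexpD xmon_mexp.
have /eqP -> : qpi I 'X_[U_(j) + a] == 0 by rewrite qpi_eq0; have /negPn := allI j.
by rewrite scaler0.
Qed.

Lemma inner_root_summand (a b : 'X_{1..n}) :
  mexp a != 0 -> inner_root I (mexp (a + b)%MM) -> inner_root I (mexp a).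
Proof.
move=> a0 /inner_rootP[_ [j Xj]]; apply/inner_rootP; split=> //.
exists j; apply: contra Xj => Xa.
by rewrite addmA mpolyXD mulrC; apply: idealMr.
Qed.

(** With [l = s + 3], the two scalars inverted are [l-1] and [l-2], the
    eigenvalues of [q |-> (l-1) q - q(e_i) u], where [u] is the [i]-th coordinate. *)
Lemma bracket_axis_onto (i : 'I_n) (s : nat) :
  s.+1%:R != 0 :> k -> s.+2%:R != 0 :> k ->
  forall r, exists p q, forall x : qalg I,
    bracket (hder_bar (mexp U_(i)%MM) p)
            (hder_bar (mexp (U_(i) *+ s.+2)%MM) q) x =
      hder_bar (mexp (U_(i) *+ s.+3)%MM) r x.
Proof.
move=> s1 s2 r; pose c := r (ebase i) / s.+1%:R.
exists (dual_of (fun j => (j == i)%:R)).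
(* [c] is the value of [q] at [e_i]: it solves [c = (r(e_i) + c) / (l-1)]. *)
exists (dual_of (fun j => (r (ebase j) + c * (j == i)%:R) / s.+2%:R)) => x.
rewrite [(U_(i) *+ s.+3)%MM]mulmS; apply: bracket_hder_bar => j.
rewrite -ebase_muln mexp1 raddfMn /= !dual_of_ebase eqxx mulr1 /c.
move: s1 s2; rewrite -[s.+2]addn1 natrD; move: (s.+1%:R) => t t0 t1.
by field; apply/andP.
Qed.

End Derivations.

Theorem lemma4p4 (k : closedFieldType) (char0 : [pchar k] =i pred0)
    (n : nat) (n_gt0 : (0 < n)%N) (I : idealr {mpoly k[n]})
    (I_mono : monomial_ideal I) (I_cofin : cofinite_support I)
    (xj_notin : forall j : 'I_n, 'X_j \notin (I : {pred {mpoly k[n]}}))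
    (i : 'I_n) (l : nat) (l_gt2 : (2 < l)%N)
    (g_inner : inner_root I (ebase i *+ l)) :
  (forall r : dualN n k,
     exists (p q : dualN n k) (a b : deg n),
       [/\ inner_root I a, inner_root I b,
           a != ebase i *+ l, b != ebase i *+ l
         & a + b = ebase i *+ l /\
           (forall x : qalg I,
              bracket (hder_bar a p) (hder_bar b q) x =
                hder_bar (ebase i *+ l) r x)])
  /\ reducible I (ebase i *+ l).
Proof.
case: l l_gt2 g_inner => [|[|[|s]]] // _; rewrite ebase_muln => g_inner.
have nat_neq0 e : e.+1%:R != 0 :> k by have /pcharf0P -> := char0.
have onto := bracket_axis_onto I_mono i (nat_neq0 s) (nat_neq0 s.+1).
have axis_inj e e' :
    (mexp (U_(i) *+ e)%MM == mexp (U_(i) *+ e')%MM) = (e == e').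
  apply/eqP/eqP => [/rowP/(_ i)|-> //].
  by rewrite !mxE !mulmnE mnm1E eqxx !mul1n => -[].
have axis_neq0 e : mexp (U_(i) *+ e.+1)%MM != 0.
  have -> : 0 = mexp (U_(i) *+ 0)%MM by apply/rowP => h; rewrite !mxE mulmnE muln0.
  by rewrite axis_inj.
have a_inner : inner_root I (mexp U_(i)%MM).
  move: g_inner; rewrite mulmS.
  exact: (inner_root_summand I_mono (axis_neq0 0%N)).
have b_inner : inner_root I (mexp (U_(i) *+ s.+2)%MM).
  move: g_inner; rewrite mulmSr.
  exact: (inner_root_summand I_mono (axis_neq0 s.+1)).
have ab : mexp U_(i)%MM + mexp (U_(i) *+ s.+2)%MM = mexp (U_(i) *+ s.+3)%MM.
  by rewrite -mexpD -mulmS.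
split=> [r|].
  have [p [q pqr]] := onto r.
  exists p, q, (mexp U_(i)%MM), (mexp (U_(i) *+ s.+2)%MM); split=> //.
  (* [U_(i)] is convertible to [U_(i) *+ 1]. *)
  - exact: (negbT (axis_inj 1 s.+3)).
  - by rewrite axis_inj ltn_eqF.
split=> [|D]; first exact: g_inner.1.
split=> [|/(gspace_hder_barP I_mono)[r Dr]]; first exact: Bspace_gspace.
have [p [q pqr]] := onto r.
exists 1, (fun=> 1), (fun=> mexp U_(i)%MM), (fun=> mexp (U_(i) *+ s.+2)%MM).
exists (fun=> hder_bar (mexp U_(i)%MM) p).
exists (fun=> hder_bar (mexp (U_(i) *+ s.+2)%MM) q).
split=> [_|x]; last by rewrite big_ord1 scale1r pqr.
split; [exact: a_inner.1 | exact: b_inner.1 | exact: ab | |].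
  exact: gspace_hder_bar.
exact: gspace_hder_bar.
Qed.
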